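(* Let $p, q_0, q$ be terms in the language of power-set algebras, in variables $\mathbf{x} = x_1,\ldots,x_k$, and let $V$ be a variable not among $x_1,\ldots,x_k$. Then the following are equivalent: (a) the argument $p = 0,\ q_0 \neq 0\ \therefore\ q \neq 0$ is valid; (b) the argument $p = 0,\ V\cdot q_0' = 0\ \therefore\ V\cdot q' = 0$ is valid.
   Context: Terms are built from variables (from a countably infinite set $X$) and the constants $0,1$ using the operation symbols $\cup$, $\cap$ (also written $\cdot$ or juxtaposition) and $'$ (complement). For a nonempty set $U$, an interpretation $I$ into the power-set algebra of $U$ assigns to each variable a subset of $U$ and is extended to all terms by reading $0$ as $\emptyset$, $1$ as $U$, and $\cup,\cap,{}'$ as union, intersection and complement in $U$. A formula $s=t$ is true under $I$ iff $I(s)=I(t)$, and $s\neq t$ is true under $I$ iff $I(s)\neq I(t)$. An argument $\varphi_1,\ldots,\varphi_n\ \therefore\ \psi$ is valid if, for every nonempty set $U$ and every interpretation $I$ into the power-set algebra of $U$ under which all of $\varphi_1,\ldots,\varphi_n$ are true, $\psi$ is also true under $I$. *)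

(* Defs.v *)
From Stdlib Require List.
From mathcomp Require Import all_boot.
From mathcomp Require Import classical_sets.

Set Implicit Arguments.
Unset Strict Implicit.
Unset Printing Implicit Defensive.

Local Open Scope classical_set_scope.

(* The countably infinite set X of variables. *)
Definition var := nat.

Inductive term : Type :=
  | Var of var
  | Zero
  | One
  | Cup of term & term
  | Cap of term & term
  | Compl of term.

Fixpoint term_vars (t : term) : seq var :=
  match t with
  | Var v => [:: v]
  | Zero | One => [::]
  | Cup s t | Cap s t => term_vars s ++ term_vars t
  | Compl s => term_vars s
  end.

Definition term_in (x : seq var) (t : term) : Prop :=
  {subset term_vars t <= x}.

Fixpoint interp (U : Type) (I : var -> set U) (t : term) : set U :=
  match t with
  | Var v => I v
  | Zero => set0
  | One => setT
  | Cup s t => interp I s `|` interp I t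
  | Cap s t => interp I s `&` interp I t
  | Compl s => ~` interp I s
  end.

Inductive formula : Type :=
  | Eqn of term & term
  | Neqn of term & term.

Definition holds (U : Type) (I : var -> set U) (phi : formula) : Prop :=
  match phi with
  | Eqn s t => interp I s = interp I t
  | Neqn s t => interp I s <> interp I t
  end.

Definition valid (phis : seq formula) (psi : formula) : Prop :=
  forall U : Type, inhabited U -> forall I : var -> set U,
    (forall phi, List.In phi phis -> holds I phi) -> holds I psi.

(* Main.v *)
Require Import Defs.
From mathcomp Require Import all_boot.
From mathcomp Require Import boolp classical_sets.

(** Both arguments say that every interpretation killing [p] makes [q0] a
    subset of [q]; (a) only seems weaker, claiming that [q] is nonempty when
    [q0] is.

    From (a) to (b): a point [u] of [V] outside [q] lies in [q0].  Evaluating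
    all terms at [u] amounts to interpreting them in the power set of a
    one-point set ([interp_preimage]); there [p] is empty, [q0] is everything
    and [q] is empty, against (a).

    From (b) to (a): as [V] occurs in none of the terms, it may be reinterpreted
    as [q0] without changing them ([interp_eq_in]).  The premise of (b) on [V]
    becomes trivial and its conclusion reads [q0 `<=` q], so [q] inherits a point
    from [q0]. *)

Local Open Scope classical_set_scope.

(** Preimage along any map commutes with the Boolean operations, hence with all
    terms; for the inclusion of a point this is evaluation at that point. *)
Lemma interp_preimage (W U : Type) (f : W -> U) (I : var -> set U) (t : term) :
  interp (fun v => f @^-1` I v) t = f @^-1` interp I t.
Proof. by elim: t => //= [s -> t -> | s -> t -> | s ->]. Qed.

Lemma interp_eq_in (U : Type) (I J : var -> set U) (t : term) :
  (forall v, v \in term_vars t -> I v = J v) -> interp I t = interp J t.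
Proof.
elim: t => //= [v | s IHs t IHt | s IHs t IHt | s IHs] eqIJ.
- by apply: eqIJ; rewrite mem_head.
- by rewrite IHs ?IHt // => v v_in; apply: eqIJ; rewrite mem_cat v_in ?orbT.
- by rewrite IHs ?IHt // => v v_in; apply: eqIJ; rewrite mem_cat v_in ?orbT.
- by rewrite IHs.
Qed.

Definition update {U : Type} (I : var -> set U) (V : var) (A : set U) :
  var -> set U := fun v => if v == V then A else I v.

Lemma interp_update (U : Type) (I : var -> set U) (x : seq var) (V : var)
    (A : set U) (t : term) :
  term_in x t -> V \notin x -> interp (update I V A) t = interp I t.
Proof.
move=> t_in V_notin; apply: interp_eq_in => v /t_in v_in.
by rewrite /update; case: eqP => // eqvV; rewrite -eqvV v_in in V_notin.
Qed.

Lemma valid2P (phi1 phi2 psi : formula) :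
  valid [:: phi1; phi2] psi <->
  forall U : Type, inhabited U -> forall I : var -> set U,
    holds I phi1 -> holds I phi2 -> holds I psi.
Proof.
split=> [v12 U U0 I h1 h2 | h12 U U0 I h].
  by apply: v12 => // phi /= [<- | [<- | []]].
by apply: h12 => //; apply: h => /=; [left | right; left].
Qed.

Theorem theorem5p8 (k : nat) (x : k.-tuple var) (V : var) (p q0 q : term)
    (hp : term_in x p) (hq0 : term_in x q0) (hq : term_in x q)
    (hV : V \notin x) :
  valid [:: Eqn p Zero; Neqn q0 Zero] (Neqn q Zero) <->
  valid [:: Eqn p Zero; Eqn (Cap (Var V) (Compl q0)) Zero]
        (Eqn (Cap (Var V) (Compl q)) Zero).
Proof.
rewrite !valid2P /=; split=> [valid_a U _ I p0 | valid_b U U0 I p0 q0_neq0 q_eq0].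
- rewrite -!setDE !setD_eq0 => V_sub_q0 u Vu; apply: contrapT => q_notu.
  pose J (v : var) : set unit := (fun=> u) @^-1` I v.
  apply: (valid_a unit (inhabits tt) J); rewrite /J interp_preimage.
  + by rewrite p0 preimage_set0.
  + by apply/eqP/set0P; exists tt; apply: V_sub_q0.
  + by apply/seteqP; split=> // w /q_notu.
- have := valid_b U U0 (update I V (interp I q0)).
  rewrite !(interp_update _ _ x) // /update eqxx setICr.
  rewrite -setDE setD_eq0 q_eq0 subset0 => q0_eq0.
  exact/q0_neq0/q0_eq0.
Qed.
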